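(* Let $t$ be rational with $t\neq0,\pm1,\pm2$, let $k\ge1$ be a natural number and let $t_k=C_{2^k}(t)$. Then $$\Pi_0(-t_k)=\Pi_{k+1}(t),\qquad \Pi_1(-t_k)=\bigcup_{j=0}^{k}\Pi_j(t),$$ and further $\Pi_j(-t_k)=\Pi_{j+k}(t)$ for any $j\ge2$. Here $\Pi_j(a)=\Pi_j(a,2)$.
   Context: For rational $a$ put $D_a=\begin{pmatrix}0&-1\\1&a\end{pmatrix}$. Chebyshev polynomials of the first kind: $C_0(x)=2$, $C_1(x)=x$, $C_{n+1}=xC_n-C_{n-1}$. For rational $a\ne0,\pm1,\pm2$, $\Pi(a)$ is the set of primes $p\ge 3$ not dividing the denominator of $a$. For $p\in\Pi(a)$ the index $\chi(a,p)$ is the smallest integer $k\ge1$ with $D_a^k\equiv I \pmod p$. For $j\ge 0$, $\Pi_j(a,2)=\{p\in\Pi(a) : 2^j \,\|\, \chi(a,p)\}$ (exact power of $2$ dividing the index). *)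

(* Defs.v *)
From HB Require Import structures.
From mathcomp Require Import all_boot all_order all_algebra all_fingroup all_solvable.

Set Implicit Arguments.
Unset Strict Implicit.
Unset Printing Implicit Defensive.

Import Order.TTheory GRing.Theory Num.Theory.
Local Open Scope ring_scope.

Definition D (a : rat) : 'M[rat]_2 :=
  \matrix_(i < 2, j < 2) nth 0 (nth [::] [:: [:: 0; -1]; [:: 1; a]] i) j.

(* Normalized so that (C n).[x + x^-1] = x ^+ n + x ^- n; hence C 0 = 2. *)
Fixpoint C (n : nat) : {poly rat} :=
  match n with
  | 0 => 2%:P
  | 1 => 'X
  | (m.+1 as m').+1 => 'X * C m' - C m
  end.

(* Congruence of rationals modulo a prime p, i.e. x - y in p Z_(p): as the
   fraction numq / denq is reduced, p %| numq forces p not to divide denq. *)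
Definition eqmodq (p : nat) (x y : rat) : bool := (p %| numq (x - y))%Z.

Definition eqmodmx (p : nat) (A B : 'M[rat]_2) : bool :=
  [forall i, forall j, eqmodq p (A i j) (B i j)].

(* The sets are considered for a different from 0, 1, -1, 2, -2 only; this
   restriction is a hypothesis where they are used, not part of the
   definition. *)
Definition Pi (a : rat) : pred nat :=
  [pred p | [&& prime p, (3 <= p)%N & ~~ (p %| denq a)%Z]].

Definition is_period (a : rat) (p : nat) : pred nat :=
  [pred k | (1 <= k)%N && eqmodmx p (D a ^+ k) 1].

Lemma period_exists (a : rat) (p : nat) :
  p \in Pi a -> exists k, is_period a p k.
Proof.
case/and3P=> p_pr _ pNd.
have chFp := pchar_Fp p_pr.
set d := denq a; set n := numq a.
pose E (R : nzRingType) : 'M[R]_2 := \matrix_(i < 2, j < 2)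
  nth 0 (nth [::] [:: [:: 0; - d%:~R]; [:: d%:~R; n%:~R]] i) j.
have mapE (R S : nzRingType) (f : {rmorphism R -> S}) : map_mx f (E R) = E S.
  apply/matrixP=> i j; rewrite !mxE.
  by case: i j => [[|[|i]] //= _] [[|[|j]] //= _];
    rewrite ?rmorph0 ?rmorphN ?rmorph_int.
have dE : (d%:~R *: D a) = E rat.
  apply/matrixP=> i j; rewrite !mxE.
  case: i j => [[|[|i]] //= _] [[|[|j]] //= _];
    rewrite ?mulr0 ?mulrN ?mulr1 //.
  by rewrite /n numqE mulrC.
have d0 : d%:~R != 0 :> 'F_p by rewrite -(dvdz_pcharf chFp).
have uE : E 'F_p \is a GRing.unit.
  rewrite -[_ \is a _]/(_ \in unitmx) unitmxE (expand_det_row _ 0).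
  rewrite !big_ord_recl big_ord0 !mxE /= mul0r add0r addr0 /cofactor /=.
  rewrite det_mx11 !mxE /= mulN1r mulrNN unitfE.
  by apply: mulf_neq0.
pose gT : finGroupType := {unit 'M['F_p]_2}.
have pow1 (A : 'M['F_p]_2) : A \is a GRing.unit -> A ^+ #|[set: gT]| = 1.
  move=> uA; pose u : gT := FinRing.Unit uA.
  have /(congr1 val) := expg_cardG (in_setT u).
  by rewrite FinRing.val_unitX FinRing.val_unit1.
pose N : nat := #|[set: gT]|; rewrite -/N in pow1.
have N0 : (0 < N)%N by apply: cardG_gt0.
exists N.
rewrite /is_period /= N0 /=; apply/'forall_forallP=> i j.
have EN : E 'F_p ^+ N = 1 by apply: pow1.
have dN : d%:~R ^+ N = 1 :> 'F_p.
  have : (d%:~R)%:M ^+ N = 1 :> 'M['F_p]_2.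
    apply: pow1; rewrite -[_ \is a _]/(_ \in unitmx) unitmxE det_scalar.
    by rewrite unitfE expf_neq0.
  by rewrite -rmorphXn => /matrixP/(_ 0 0); rewrite !mxE eqxx.
pose z : int := (E int ^+ N) i j - d ^+ N * (i == j)%:R.
have pz : (p %| z)%Z.
  rewrite (dvdz_pcharf chFp) /z rmorphB rmorphM rmorphXn /= rmorph_nat.
  have -> : ((E int ^+ N) i j)%:~R = (E 'F_p ^+ N) i j.
    by rewrite -(mapE int 'F_p intr) -rmorphXn /= !mxE.
  by rewrite EN dN mul1r !mxE subrr.
have zE : z%:~R = d%:~R ^+ N * ((D a ^+ N) i j - 1%:M i j) :> rat.
  rewrite /z rmorphB rmorphM rmorphXn /= rmorph_nat mulrBr !mxE; congr (_ - _).
  have -> : ((E int ^+ N) i j)%:~R = (E rat ^+ N) i j.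
    by rewrite -(mapE int rat intr) -rmorphXn /= !mxE.
  by rewrite -dE exprZn !mxE.
rewrite /eqmodq; set x := _ - _ in zE *.
have : z * denq x = d ^+ N * numq x.
  apply/eqP; rewrite -(eqr_int rat) !rmorphM rmorphXn /= zE -mulrA.
  by rewrite -{1}(divq_num_den x) divfK ?intr_eq0 ?denq_eq0.
move=> eqz; have : (p %| d ^+ N * numq x)%Z by rewrite -eqz dvdz_mulr.
rewrite Gauss_dvdzr //.
by rewrite coprimezXr // coprimezE prime_coprime.
Qed.

(* The index; the value 0 outside Pi a is a dummy. *)
Definition chi (a : rat) (p : nat) : nat :=
  if @idP (p \in Pi a) is ReflectT pPi then ex_minn (period_exists pPi) else 0.

Lemma chiP (a : rat) (p : nat) : p \in Pi a ->
  is_period a p (chi a p) /\ forall k, is_period a p k -> (chi a p <= k)%N.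
Proof. by rewrite /chi; case: {-}_ / idP => // pPi _; case: ex_minnP. Qed.

Definition Pi_ (j : nat) (a : rat) : pred nat :=
  [pred p | [&& p \in Pi a, (2 ^ j %| chi a p)%N & ~~ (2 ^ j.+1 %| chi a p)%N]].

(* Main.v *)
Require Import Defs.
From mathcomp Require Import all_boot all_order all_algebra.
From mathcomp Require Import ring zify.
Import Order.TTheory GRing.Theory Num.Theory.
Local Open Scope ring_scope.

(** The theorem says how the exponent v(a) of 2 in the index chi(a, p) changes
    when a = t is replaced by - C_(2^k)(t), and all three equalities follow from

      v(- C_(2^k)(t)) <= j + 1  iff  v(t) <= j + 1 + k      (for all j >= 0),
      v(- C_(2^k)(t)) = 0       iff  v(t) = k + 1.

    The idea is to read v(a) off traces.  The matrix D_a has determinant 1 and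
    trace a, so the trace of D_a^n is C_n(a).  If D_a^n = 1 modulo p then
    C_n(a) = 2.  Conversely, a matrix of determinant 1 and trace 2 over F_p
    is unipotent by Cayley-Hamilton, so its p-th power is 1; thus C_n(a) = 2
    gives D_a^(n p) = 1.  As p is odd, the loss of the factor p does not affect
    the 2-part, and [logn_chi_leP] results: v(a) <= j iff C_(2^j m)(a) = 2 in
    F_p for some odd m.  Eigenvalues never enter, so the degenerate residues
    a = 2, -2 modulo p, where D_a is not diagonalizable, need no special
    treatment.

    What remains is calculation with C_m(C_n(a)) = C_(n m)(a) and
    C_n(-a) = (-1)^n C_n(a).  For an even degree n = 2^(j+1) m the sign
    disappears, which gives the first equivalence ([logn_chi_opp_cheb]).  For an
    odd degree m the condition becomes C_(2^k m)(t) = -2; since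
    C_(2 n) = C_n^2 - 2, this says that C_(2^(k+1) m)(t) = 2 while
    C_(2^k m)(t) is not 2, hence the second one ([logn_chi_opp_cheb_eq0]).

    The rational numbers enter only through their residues in F_p.  That t and
    C_(2^k)(t) have the same admissible primes holds because C_(2^(k+1)) =
    C_(2^k)^2 - 2 and a rational whose square is p-integral is p-integral. *)

(** * Chebyshev polynomials as traces *)

(** The values C_n(u) over any ring, so that one recurrence serves the rational
    numbers and their residues alike. *)
Fixpoint cheb {R : comNzRingType} (u : R) (n : nat) : R :=
  match n with
  | 0 => 2
  | 1 => u
  | (m.+1 as m').+1 => u * cheb u m' - cheb u m
  end.

(** [D a] is convertible to [Dmx a] over the rational numbers. *)
Definition Dmx {R : comNzRingType} (u : R) : 'M[R]_2 :=
  \matrix_(i < 2, j < 2) nth 0 (nth [::] [:: [:: 0; -1]; [:: 1; u]] i) j.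

Lemma nat_ind2 (P : nat -> Prop) :
  P 0 -> P 1 -> (forall n, P n -> P n.+1 -> P n.+2) -> forall n, P n.
Proof.
move=> P0 P1 PS n; suff [] : P n /\ P n.+1 by [].
by elim: n => [|n [Pn Pn1]]; split=> //; apply: PS.
Qed.

Lemma chebSS {R : comNzRingType} (u : R) n :
  cheb u n.+2 = u * cheb u n.+1 - cheb u n.
Proof. by []. Qed.

Lemma ord2P (i : 'I_2) : i = 0 \/ i = 1.
Proof. by case: i => [[|[|]]] // ?; [left | right]; apply/val_inj. Qed.

Lemma big_ord2 {R : comNzRingType} (F : 'I_2 -> R) : \sum_i F i = F 0 + F 1.
Proof.
by rewrite !big_ord_recl big_ord0 addr0; congr (_ + F _); apply/val_inj.
Qed.

Lemma det_mx22 {R : comNzRingType} (M : 'M[R]_2) :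
  \det M = M 0 0 * M 1 1 - M 0 1 * M 1 0.
Proof.
rewrite (expand_det_row _ 0) big_ord2 /cofactor !det_mx11 !mxE /=.
have -> : lift 0 0 = 1 :> 'I_2 by apply/val_inj.
have -> : lift 1 0 = 0 :> 'I_2 by apply/val_inj.
by rewrite expr0 expr1; ring.
Qed.

Lemma Cayley_Hamilton_SL2 {R : comNzRingType} (M : 'M[R]_2) :
  \det M = 1 -> M * M = \tr M *: M - 1.
Proof.
rewrite det_mx22 /mxtrace big_ord2 => detM.
apply/matrixP=> i j; rewrite !mxE big_ord2 -detM.
by case: (ord2P i) => ->; case: (ord2P j) => -> /=; ring.
Qed.

(** Cayley-Hamilton, multiplied by a power of [M], becomes the Chebyshev
    recurrence after taking traces. *)
Lemma trace_exp {R : comNzRingType} (M : 'M[R]_2) n :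
  \det M = 1 -> \tr (M ^+ n) = cheb (\tr M) n.
Proof.
move=> /Cayley_Hamilton_SL2 CH; elim/nat_ind2: n => [|//|n IH0 IH1].
  by rewrite expr0 mxtrace1.
rewrite chebSS -IH0 -IH1 -mxtraceZ -raddfB /=; congr (\tr _).
by rewrite !exprS mulrA CH mulrBl mul1r -scalerAl.
Qed.

Lemma det_exp {R : comNzRingType} (M : 'M[R]_2) n :
  \det M = 1 -> \det (M ^+ n) = 1.
Proof.
move=> dM; elim: n => [|n IH]; first by rewrite expr0 det1.
by rewrite exprS -mulmxE det_mulmx dM IH mulr1.
Qed.

Lemma det_Dmx {R : comNzRingType} (u : R) : \det (Dmx u) = 1.
Proof. by rewrite det_mx22 !mxE /=; ring. Qed.

Lemma trace_Dmx_exp {R : comNzRingType} (u : R) n : \tr (Dmx u ^+ n) = cheb u n.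
Proof.
by rewrite trace_exp ?det_Dmx // /mxtrace big_ord2 !mxE /= add0r.
Qed.

(** Both sides are the trace of the [m]-th power of [Dmx u ^+ n], a matrix of
    determinant 1 and trace [cheb u n]. *)
Lemma cheb_comp {R : comNzRingType} (u : R) m n :
  cheb (cheb u n) m = cheb u (n * m).
Proof.
by rewrite -(trace_Dmx_exp u) -trace_exp -?exprM ?trace_Dmx_exp
           ?det_exp ?det_Dmx.
Qed.

Lemma chebN {R : comNzRingType} (u : R) n : cheb (- u) n = (-1) ^+ n * cheb u n.
Proof.
elim/nat_ind2: n => [||n IH0 IH1]; first by rewrite mul1r.
  by rewrite expr1 mulN1r.
by rewrite !chebSS IH0 IH1 !exprS; ring.
Qed.

Lemma cheb_at2 {R : comNzRingType} n : cheb 2 n = 2 :> R.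
Proof.
by elim/nat_ind2: n => [||n IH0 IH1] //; rewrite chebSS IH0 IH1; ring.
Qed.

Lemma cheb_double {R : comNzRingType} (u : R) n :
  cheb u (n * 2) = cheb u n ^+ 2 - 2.
Proof. by rewrite -cheb_comp /= expr2. Qed.

Lemma horner_C (x : rat) n : (C n).[x] = cheb x n.
Proof.
elim/nat_ind2: n => [||n IH0 IH1]; rewrite ?hornerC ?hornerX //.
by rewrite chebSS -IH0 -IH1 /= hornerD hornerN hornerM hornerX.
Qed.

(** By Cayley-Hamilton [M - 1] has square 0, so [M ^+ n = 1 + (M - 1) *+ n], and
    [p] kills the second term. *)
Lemma SL2_trace2_exp (p : nat) (M : 'M['F_p]_2) :
  prime p -> \det M = 1 -> \tr M = 2 -> M ^+ p = 1.
Proof.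
move=> p_pr dM tM; have CH := Cayley_Hamilton_SL2 _ dM.
have N2 : (M - 1) * (M - 1) = 0.
  rewrite mulrBl mulrBr !mulr1 mul1r CH tM scaler_nat mulr2n.
  by rewrite [M + M - 1 - M]addrAC addrK subrr.
have ME n : M ^+ n = 1 + (M - 1) *+ n.
  elim: n => [|n IH]; first by rewrite mulr0n addr0.
  rewrite exprSr IH -{2}(subrK 1 M) mulrDr mulr1 mulrDl mul1r.
  by rewrite mulrnAl N2 mul0rn addr0 mulrS addrCA.
by rewrite ME -scaler_nat (pchar_Fp_0 p_pr) scale0r addr0.
Qed.

(** * Residues of rational numbers modulo a prime *)

(** A relation rather than a function: any fraction [n / d] whose denominator is
    prime to [p] may be used as a witness, so that compatibility with the ring
    operations involves no reduced fractions.  Uniqueness of the residue is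
    contained in [reduces_eq0]. *)
Definition reduces (p : nat) (x : rat) (u : 'F_p) : Prop :=
  exists n d : int,
    [/\ d%:~R != 0 :> 'F_p, x * d%:~R = n%:~R & u * d%:~R = n%:~R].

Lemma reducesD p x y u v :
  reduces p x u -> reduces p y v -> reduces p (x + y) (u + v).
Proof.
move=> [n [d [d0 xd ud]]] [m [e [e0 ye ve]]]; exists (n * e + m * d), (d * e).
rewrite !rmorphD !rmorphM /= mulf_neq0 // -xd -ud -ye -ve.
by split=> //; ring.
Qed.

Lemma reducesM p x y u v :
  reduces p x u -> reduces p y v -> reduces p (x * y) (u * v).
Proof.
move=> [n [d [d0 xd ud]]] [m [e [e0 ye ve]]]; exists (n * m), (d * e).
rewrite !rmorphM /= mulf_neq0 // -xd -ud -ye -ve.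
by split=> //; ring.
Qed.

Lemma reduces_int p (z : int) : reduces p z%:~R z%:~R.
Proof. by exists z, 1; rewrite !mulr1 oner_neq0. Qed.

Lemma reducesN p x u : reduces p x u -> reduces p (- x) (- u).
Proof.
by move/(reducesM _ _ _ _ _ (reduces_int p (-1))); rewrite !rmorphN !mulN1r.
Qed.

Lemma reduces_cheb p x u n : reduces p x u -> reduces p (cheb x n) (cheb u n).
Proof.
move=> xu; elim/nat_ind2: n => [||n IH0 IH1] //; first exact: (reduces_int p 2).
by rewrite !chebSS; apply: reducesD; [apply: reducesM | apply: reducesN].
Qed.

Lemma reduces_Dmx_exp p x u n i j :
  reduces p x u -> reduces p ((Dmx x ^+ n) i j) ((Dmx u ^+ n) i j).
Proof.
move=> xu; elim: n i j => [|n IH] i j.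
  by rewrite !expr0 !mxE; apply: (reduces_int p (i == j)%:Z).
rewrite !exprS !mxE !big_ord2.
apply: reducesD; (apply: reducesM; last exact: IH);
  rewrite !mxE; case: (ord2P i) => -> /=;
  first [ exact: (reduces_int p 0) | exact: (reduces_int p 1)
        | exact: (reduces_int p (-1)) | exact: xu ].
Qed.

Lemma num_den_Fp_neq0 p (x : rat) : prime p ->
  (denq x)%:~R = 0 :> 'F_p -> (numq x)%:~R != 0 :> 'F_p.
Proof.
move=> p_pr /eqP; have chFp := pchar_Fp p_pr.
rewrite -!(dvdz_pcharf chFp) !dvdzE /= => pd; apply/negP => pn.
have := coprime_num_den x; rewrite /coprime => /eqP gcd1.
by have := prime_gt1 p_pr; rewrite ltnNge dvdn_leq // -gcd1 dvdn_gcd pn pd.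
Qed.

Lemma reduces_num_den p x u : reduces p x u ->
  (numq x)%:~R = u * (denq x)%:~R :> 'F_p.
Proof.
move=> [n [d [d0 xd ud]]]; apply: (mulIf d0).
rewrite mulrAC ud -!rmorphM /=; congr (_%:~R).
apply/eqP; rewrite -(eqr_int rat) !rmorphM /= -xd numqE; apply/eqP; ring.
Qed.

(** The reduced denominator is nonzero in F_p: otherwise the reduced numerator
    would vanish there too. *)
Lemma reduces_eq0 p x u : prime p ->
  reduces p x u -> (p %| numq x)%Z = (u == 0).
Proof.
move=> p_pr /reduces_num_den E.
rewrite (dvdz_pcharf (pchar_Fp p_pr)) E mulf_eq0.
case: eqP => //= _; apply/eqP => D0.
by have /eqP[] := num_den_Fp_neq0 _ _ p_pr D0; rewrite E D0 mulr0.
Qed.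

Lemma reducesP p x : prime p -> ~~ (p %| denq x)%Z <-> exists u, reduces p x u.
Proof.
move=> p_pr; rewrite (dvdz_pcharf (pchar_Fp p_pr)); split=> [d0 | [u xu]].
  exists ((numq x)%:~R / (denq x)%:~R), (numq x), (denq x).
  by rewrite divfK // numqE.
apply/eqP => D0; have /eqP[] := num_den_Fp_neq0 _ _ p_pr D0.
by rewrite (reduces_num_den _ _ _ xu) D0 mulr0.
Qed.

Lemma reduces_sqr p x u : prime p ->
  reduces p (x ^+ 2) u -> exists v, reduces p x v.
Proof.
move=> p_pr [n [d [d0 xd _]]]; apply/reducesP => //.
rewrite (dvdz_pcharf (pchar_Fp p_pr)); apply/eqP => D0.
have /eqP[] := num_den_Fp_neq0 _ _ p_pr D0.
have E : numq x * numq x * d = n * (denq x * denq x).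
  apply/eqP; rewrite -(eqr_int rat) !rmorphM /= -xd numqE.
  by apply/eqP; ring.
have /eqP : (numq x * numq x * d)%:~R = 0 :> 'F_p.
  by rewrite E !rmorphM /= D0 !mulr0.
by rewrite !rmorphM /= !mulf_eq0 (negPf d0) orbF orbb => /eqP.
Qed.

(** Descent along [cheb x (2 ^ k.+1) = cheb x (2 ^ k) ^+ 2 - 2]. *)
Lemma reduces_cheb_inv p x u k : prime p ->
  reduces p (cheb x (2 ^ k)) u -> exists v, reduces p x v.
Proof.
move=> p_pr; elim: k u => [|k IH] u; first by exists u.
rewrite expnSr cheb_double => /reducesD/(_ (reduces_int p 2)).
by rewrite subrK => /(reduces_sqr _ _ _ p_pr)[v /IH].
Qed.

Lemma Pi_opp_cheb p x k : (p \in Pi (- cheb x (2 ^ k))) = (p \in Pi x).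
Proof.
rewrite !inE; have [p_pr /= | //] := boolP (prime p); congr (_ && _).
apply/idP/idP => /(reducesP _ _ p_pr)[u xu]; apply/reducesP => //.
  by move/reducesN: xu; rewrite opprK; apply: reduces_cheb_inv.
by exists (- cheb u (2 ^ k)); apply/reducesN/reduces_cheb.
Qed.

(** * The 2-adic valuation of the index *)

Lemma is_periodE a p u m : prime p -> reduces p a u ->
  is_period a p m = (0 < m)%N && (Dmx u ^+ m == 1).
Proof.
move=> p_pr au; congr (_ && _).
have E i j :
    eqmodq p ((D a ^+ m) i j) ((1 : 'M_2) i j)
    = ((Dmx u ^+ m) i j == (1 : 'M_2) i j).
  rewrite /eqmodq (reduces_eq0 _ _ ((Dmx u ^+ m) i j - (1 : 'M_2) i j)) //.
    by rewrite subr_eq0.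
  apply: reducesD; first exact: reduces_Dmx_exp.
  by apply: reducesN; rewrite !mxE; apply: (reduces_int p (i == j)%:Z).
apply/idP/eqP => [/'forall_forallP H | H].
  by apply/matrixP => i j; apply/eqP; rewrite -E.
by apply/'forall_forallP => i j; rewrite E H.
Qed.

Lemma Dmx_exp_eq1 a p u m : p \in Pi a -> reduces p a u ->
  (Dmx u ^+ m == 1) = (chi a p %| m)%N.
Proof.
move=> pPi au; have p_pr : prime p by case/and3P: pPi.
have [] := chiP pPi.
rewrite (is_periodE _ _ _ _ p_pr au) => /andP[c0 /eqP c1] min.
rewrite [in LHS](divn_eq m (chi a p)) exprD mulnC exprM c1 expr1n mul1r.
apply/eqP/idP => [r1 | /eqP->]; last by rewrite expr0.
have := min (m %% chi a p)%N; rewrite (is_periodE _ _ _ _ p_pr au) r1 eqxx andbT.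
by rewrite /dvdn lt0n leqNgt ltn_mod c0; case: eqP => // _ /(_ isT).
Qed.

Lemma chi_gt0 a p : p \in Pi a -> (0 < chi a p)%N.
Proof. by case/chiP => /andP[]. Qed.

Lemma Pi_logn j a p : (p \in Pi_ j a) = (p \in Pi a) && (logn 2 (chi a p) == j).
Proof.
rewrite [LHS]inE; have [pPi /= | //] := boolP (p \in Pi a).
by rewrite !pfactor_dvdn ?chi_gt0 // -ltnNge ltnS eqn_leq andbC.
Qed.

(** From left to right take for [m] the odd part of the index.  From right to
    left, trace 2 only gives [Dmx u ^+ (2 ^ j * m * p) = 1], but the exponent
    of 2 in [2 ^ j * m * p] is still [j]. *)
Lemma logn_chi_leP a p u j : p \in Pi a -> reduces p a u ->
  (logn 2 (chi a p) <= j)%N <-> exists2 m, odd m & cheb u (2 ^ j * m) = 2.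
Proof.
move=> pPi au; have /and3P[p_pr p3 _] := pPi.
have c0 := chi_gt0 _ _ pPi; split=> [le_j | [m m_odd Em]].
  exists ((chi a p)`_2^')%N; first by rewrite odd_2'nat part_pnat.
  rewrite -trace_Dmx_exp; have /eqP-> : Dmx u ^+ (2 ^ j * (chi a p)`_2^')%N == 1.
    rewrite (Dmx_exp_eq1 a) // -{1}(partnC 2%N c0) dvdn_mul //.
    by rewrite p_part dvdn_exp2l.
  by rewrite mxtrace1.
have /eqP : Dmx u ^+ (2 ^ j * m * p) = 1.
  rewrite exprM; apply: SL2_trace2_exp; rewrite ?trace_Dmx_exp //.
  by rewrite det_exp ?det_Dmx.
rewrite (Dmx_exp_eq1 a) // => /(dvdn_leq_log 2).
have p_odd : odd p by case: (even_prime p_pr) p3 => [->|].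
have m0 := odd_gt0 m_odd; have p0 := odd_gt0 p_odd.
have log_odd n : odd n -> logn 2 n = 0%N.
  by move=> n_odd; rewrite lognE dvdn2 n_odd andbF.
rewrite !lognM ?muln_gt0 ?expn_gt0 // pfactorK // (log_odd m) // (log_odd p) //.
by rewrite !addn0; apply; rewrite m0 p0.
Qed.

Lemma Fp_2neqN2 p : prime p -> (3 <= p)%N -> 2 <> - 2 :> 'F_p.
Proof.
move=> p_pr p3 /eqP; rewrite -subr_eq0 opprK -natrD.
rewrite -(dvdn_pcharf (pchar_Fp p_pr)).
by rewrite -[(2 + 2)%N]/(2 ^ 2)%N Euclid_dvdX // andbT gtnNdvd.
Qed.

(** Only even degrees occur in the criterion here, and they do not see the
    sign. *)
Lemma logn_chi_opp_cheb a p u j k : p \in Pi a -> reduces p a u ->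
  (logn 2 (chi (- cheb a (2 ^ k)) p) <= j.+1)%N
    = (logn 2 (chi a p) <= j.+1 + k)%N.
Proof.
move=> pPi au.
have pPi' : p \in Pi (- cheb a (2 ^ k)) by rewrite Pi_opp_cheb.
have au' : reduces p (- cheb a (2 ^ k)) (- cheb u (2 ^ k)).
  exact/reducesN/reduces_cheb.
have E m : cheb (- cheb u (2 ^ k)) (2 ^ j.+1 * m) = cheb u (2 ^ (j.+1 + k) * m).
  by rewrite chebN cheb_comp mulnA -expnD addnC -signr_odd oddM oddX mul1r.
apply/idP/idP.
  move/(logn_chi_leP _ _ _ _ pPi' au') => [m m_odd Em].
  by apply/(logn_chi_leP _ _ _ _ pPi au); exists m; rewrite -?E.
move/(logn_chi_leP _ _ _ _ pPi au) => [m m_odd Em].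
by apply/(logn_chi_leP _ _ _ _ pPi' au'); exists m; rewrite ?E.
Qed.

(** The criterion for exponent 0 uses odd degrees, where the sign turns the
    condition into [cheb u (2 ^ k * m) = - 2].  The condition for [k.+1] is
    [cheb u (2 ^ k * m) ^+ 2 = 4], and the root 2 is the condition for [k]. *)
Lemma logn_chi_opp_cheb_eq0 a p u k : p \in Pi a -> reduces p a u ->
  (logn 2 (chi (- cheb a (2 ^ k)) p) == 0%N) = (logn 2 (chi a p) == k.+1).
Proof.
move=> pPi au; have /and3P[p_pr p3 _] := pPi.
have pPi' : p \in Pi (- cheb a (2 ^ k)) by rewrite Pi_opp_cheb.
have au' : reduces p (- cheb a (2 ^ k)) (- cheb u (2 ^ k)).
  exact/reducesN/reduces_cheb.
have E m : odd m -> cheb (- cheb u (2 ^ k)) (2 ^ 0 * m) = - cheb u (2 ^ k * m).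
  by move=> m_odd; rewrite chebN cheb_comp mul1n -signr_odd m_odd mulN1r.
rewrite -leqn0 eqn_leq ltnNge; apply/idP/andP.
  move/(logn_chi_leP _ _ _ _ pPi' au') => [m m_odd]; rewrite (E _ m_odd) => Em.
  have {}Em : cheb u (2 ^ k * m) = - 2 by rewrite -Em opprK.
  split.
    apply/(logn_chi_leP _ _ _ _ pPi au); exists m => //.
    by rewrite expnSr mulnAC cheb_double Em; ring.
  (* With cheb u (2 ^ k * n) = 2 as well, evaluate at degree 2 ^ k * n * m:
     composing in the two orders gives 2 and - 2. *)
  apply/negP => /(logn_chi_leP _ _ _ _ pPi au)[n n_odd En].
  apply: (Fp_2neqN2 _ p_pr p3).
  transitivity (cheb (cheb u (2 ^ k * n)) m); first by rewrite En cheb_at2.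
  rewrite cheb_comp mulnAC -cheb_comp Em chebN cheb_at2 -signr_odd n_odd.
  by rewrite mulN1r.
case=> /(logn_chi_leP _ _ _ _ pPi au)[m m_odd].
rewrite expnSr mulnAC cheb_double => Em not_le.
apply/(logn_chi_leP _ _ _ _ pPi' au'); exists m; rewrite // (E _ m_odd).
have /eqP : (cheb u (2 ^ k * m) - 2) * (cheb u (2 ^ k * m) + 2) = 0.
  by rewrite -(subrr (2 : 'F_p)) -[X in _ = X - 2]Em; ring.
rewrite mulf_eq0 subr_eq0 addr_eq0.
case/orP=> /eqP Em'; last by rewrite Em' opprK.
by case/negP: not_le; apply/(logn_chi_leP _ _ _ _ pPi au); exists m.
Qed.

Theorem corollary24 (t : rat) (k : nat)
    (ht : t \notin [:: 0; 1; -1; 2; -2]) (hk : (1 <= k)%N) :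
  let tk : rat := (C (2 ^ k)).[t] in
  [/\ Pi_ 0 (- tk) =i Pi_ k.+1 t,
      Pi_ 1 (- tk) =i [pred p | [exists j : 'I_k.+1, p \in Pi_ j t]] &
      forall j : nat, (2 <= j)%N -> Pi_ j (- tk) =i Pi_ (j + k) t].
Proof.
move=> tk; rewrite {}/tk horner_C.
pose v p := logn 2 (chi t p); pose w p := logn 2 (chi (- cheb t (2 ^ k)) p).
have vw p : p \in Pi t -> (w p == 0%N) = (v p == k.+1) /\
    forall j, (w p <= j.+1)%N = (v p <= j.+1 + k)%N.
  move=> pPi; have /and3P[p_pr _ /(reducesP _ _ p_pr)[u tu]] := pPi.
  split=> [|j]; first exact: (logn_chi_opp_cheb_eq0 _ _ u).
  exact: (logn_chi_opp_cheb _ _ u).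
split=> [p | p | j j2 p].
- rewrite !Pi_logn Pi_opp_cheb -/(v p) -/(w p).
  by have [/vw[-> _]|] := boolP (p \in Pi t).
- rewrite Pi_logn Pi_opp_cheb [RHS]inE -/(w p).
  transitivity ((p \in Pi t) && (v p <= k)%N).
    by have [/vw[eq0 /(_ 0%N)]|] //= := boolP (p \in Pi t); lia.
  apply/andP/existsP => [[pPi le_k] | [j]].
    by exists (Ordinal (n := k.+1) le_k); rewrite Pi_logn pPi /=.
  by rewrite Pi_logn => /andP[-> /eqP vE]; rewrite /v vE -ltnS.
- rewrite !Pi_logn Pi_opp_cheb -/(v p) -/(w p).
  have [/vw[_ le_iff]|] //= := boolP (p \in Pi t).
  case: j j2 => [|[|j]] // _; have := le_iff j; have := le_iff j.+1; lia.
Qed.
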